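(* Let $O$ be a point of the plane $\mathbb{R}^2$. The map that sends the homotopy class (in $\mathbb{R}^2\setminus\{O\}$) of a closed polygonal line $l$ in $\mathbb{R}^2\setminus\{O\}$ to the winding number $w(l,O)$ of $l$ around $O$ is a well-defined one-to-one correspondence (bijection) between the set of homotopy classes of closed polygonal lines in $\mathbb{R}^2\setminus\{O\}$ and the set $\mathbb{Z}$ of integers.
   Context: A closed (oriented) polygonal line in the plane is a finite nonempty sequence $A_1\ldots A_m$ of points of $\mathbb{R}^2$ (its vertices, not necessarily distinct), considered up to cyclic shift. It is a closed polygonal line in $N\subset\mathbb{R}^2$ if all segments $A_1A_2,\ldots,A_{m-1}A_m,A_mA_1$ are contained in $N$ (for $m=1$ this means $A_1\in N$). An elementary cancellation in $N$ of a closed polygonal line in $N$ with at least two vertices is the removal of one vertex $B$ such that, for the vertices $A,C$ adjacent to $B$ in the cyclic sequence (not necessarily distinct), the convex hull of $A,B,C$ is contained in $N$. A (piecewise linear) homotopy in $N$ is a finite sequence of closed polygonal lines in $N$ in which, of any two consecutive polygonal lines, one is obtained from the other by an elementary cancellation in $N$. Two closed polygonal lines are homotopic in $N$ if there is a homotopy in $N$ whose first and last polygonal lines are the given ones; homotopy classes are the classes of this equivalence relation. For points $A\ne O$, $B\ne O$, the oriented angle $\angle AOB$ is the number $t\in(-\pi,\pi]$ such that $\overrightarrow{OB}$ is codirected with the vector obtained from $\overrightarrow{OA}$ by the rotation through $t$. For a closed polygonal line $l=A_1\ldots A_m$ not passing through $O$ (that is, in $\mathbb{R}^2\setminus\{O\}$),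 the winding number $w(l,O)$ is defined by $$2\pi\cdot w(l,O)=\angle A_1OA_2+\angle A_2OA_3+\ldots+\angle A_{m-1}OA_m+\angle A_mOA_1 .$$ *)

(* Defs.v *)
From HB Require Import structures.
From mathcomp Require Import all_boot all_order all_algebra generic_quotient.
From mathcomp Require Import all_classical all_reals all_analysis.
Import Order.TTheory GRing.Theory Num.Theory.
Import numFieldNormedType.Exports.

Set Implicit Arguments.
Unset Strict Implicit.
Unset Printing Implicit Defensive.

Local Open Scope classical_set_scope.
Local Open Scope ring_scope.
Local Open Scope quotient_scope.

(* [R^o] rather than [R], so that the product is an [lmodType R]. *)
Notation plane R := (R^o * R^o)%type.

Section CyclicSequences.
Variable T : choiceType.

Definition nonempty_seq := {s : seq T | s != [::]}.

Definition cyclic_shift (s t : nonempty_seq) : bool :=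
  has (fun i => val t == rot i (val s)) (iota 0 (size (val s)).+1).

Lemma cyclic_shiftP (s t : nonempty_seq) :
  reflect (exists i, val t = rot i (val s)) (cyclic_shift s t).
Proof.
apply: (iffP hasP) => [[i _ /eqP ->]|[i ->]]; first by exists i.
exists (minn i (size (val s))); last by rewrite rot_minn.
by rewrite mem_iota add0n ltnS geq_minr.
Qed.

Lemma cyclic_shift_refl : reflexive cyclic_shift.
Proof. by move=> s; apply/cyclic_shiftP; exists 0%N; rewrite rot0. Qed.

Lemma cyclic_shift_sym : symmetric cyclic_shift.
Proof.
suff sub s t : cyclic_shift s t -> cyclic_shift t s.
  by move=> s t; apply/idP/idP; exact: sub.
move=> /cyclic_shiftP[i e]; apply/cyclic_shiftP.
by exists (size (val t) - i)%N; rewrite -[LHS](rotK i) -e.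
Qed.

Lemma cyclic_shift_trans : transitive cyclic_shift.
Proof.
move=> t s u /cyclic_shiftP[i e] /cyclic_shiftP[j f]; apply/cyclic_shiftP.
by rewrite f e rot_rot_add; eexists.
Qed.

Canonical cyclic_shift_equiv :=
  EquivRel cyclic_shift cyclic_shift_refl cyclic_shift_sym cyclic_shift_trans.

Definition cyclic_seq := {eq_quot cyclic_shift_equiv}.

HB.instance Definition _ := Choice.on cyclic_seq.
HB.instance Definition _ := Quotient.on cyclic_seq.
HB.instance Definition _ := EqQuotient.on cyclic_seq.

(* The cyclic sequence x s_1 ... s_n. *)
Definition cyc (x : T) (s : seq T) : cyclic_seq :=
  \pi_cyclic_seq (exist (fun s => s != [::]) (x :: s) isT).

(* The consecutive pairs (x_1, x_2), ..., (x_(m-1), x_m), (x_m, x_1). *)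
Definition cyclic_pairs (s : seq T) : seq (T * T) := zip s (rot 1 s).

Lemma cyclic_pairs_rot i (s : seq T) :
  cyclic_pairs (rot i s) = rot i (cyclic_pairs s).
Proof.
rewrite /cyclic_pairs rot_rot; move: (rot 1 s) (size_rot 1 s) => t st.
have [lt_is|le_si] := ltnP i (size s); last first.
  by rewrite !rot_oversize ?size_zip ?st ?minnn.
have e : size (take i s) = size (take i t) by rewrite !size_take_min st.
have -> : zip s t = zip (take i s) (take i t) ++ zip (drop i s) (drop i t).
  by rewrite -zip_cat // !cat_take_drop.
have {3}<- : size (zip (take i s) (take i t)) = i.
  by rewrite size_zip -e minnn size_takel // ltnW.
by rewrite rot_size_cat /rot zip_cat // !size_drop st.
Qed.

Lemma perm_cyclic_pairs (x : T) (s : seq T) :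
  perm_eq (cyclic_pairs (val (repr (cyc x s)))) (cyclic_pairs (x :: s)).
Proof.
have /eqP := reprK (cyc x s).
rewrite {2}/cyc eqmodE => /cyclic_shiftP[i /= e].
by rewrite [in X in perm_eq _ X]e cyclic_pairs_rot perm_sym perm_rot.
Qed.

End CyclicSequences.

Section ClosedPolygonalLines.
Variable R : realType.
Implicit Types (N : set (plane R)) (O A B C : plane R).

Definition segment A B : set (plane R) :=
  [set (1 - t) *: A + t *: B | t in `[0, 1]%classic].

Definition convex_hull (X : set (plane R)) : set (plane R) :=
  smallest (@convex_set R (plane R)) X.

Definition closed_line := cyclic_seq (plane R).

Definition vertices (l : closed_line) : seq (plane R) := val (repr l).

Definition line_in N (l : closed_line) : Prop :=
  forall e, e \in cyclic_pairs (vertices l) -> segment e.1 e.2 `<=` N.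

Lemma line_in_cyc N A (s : seq (plane R)) :
  line_in N (cyc A s) <->
  (forall e, e \in cyclic_pairs (A :: s) -> segment e.1 e.2 `<=` N).
Proof.
by split=> h e es; apply: h; rewrite ?(perm_mem (perm_cyclic_pairs A s)) //
  -(perm_mem (perm_cyclic_pairs A s)).
Qed.

(* Up to cyclic shift, the removed vertex B comes first: it is followed by C
   and preceded by the last vertex. *)
Definition cancellation N (l l' : closed_line) : Prop :=
  exists B C (s : seq (plane R)),
    [/\ l = cyc B (C :: s), l' = cyc C s &
        convex_hull [set last C s; B; C] `<=` N].

Definition homotopy N (ls : seq closed_line) : Prop :=
  (forall l, l \in ls -> line_in N l) /\
  sorted (fun l l' => `[< cancellation N l l' \/ cancellation N l' l >]) ls.

Definition homotopic N (l l' : closed_line) : Prop :=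
  exists ls, homotopy N (l :: ls) /\ last l ls = l'.

Definition homotopy_class N (l : closed_line) : set closed_line :=
  [set l' | homotopic N l l'].

Definition homotopy_classes N : set (set closed_line) :=
  homotopy_class N @` [set l | line_in N l].

Definition rotate (t : R) (v : plane R) : plane R :=
  (cos t * v.1 - sin t * v.2, sin t * v.1 + cos t * v.2).

Definition codirected (u v : plane R) : Prop :=
  exists2 k : R, 0 < k & u = k *: v.

(* The arbitrary value 0 is irrelevant when A and B differ from O, as the set
   is then a singleton. *)
Definition oriented_angle A O B : R :=
  xget 0 [set t : R | - pi < t <= pi /\ codirected (B - O) (rotate t (A - O))].

Definition winding_number (l : closed_line) O : R :=
  (\sum_(e <- cyclic_pairs (vertices l)) oriented_angle e.1 O e.2) / (2 * pi).

Lemma winding_number_cyc A (s : seq (plane R)) O :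
  winding_number (cyc A s) O =
  (\sum_(e <- cyclic_pairs (A :: s)) oriented_angle e.1 O e.2) / (2 * pi).
Proof.
by rewrite /winding_number (perm_big _ (perm_cyclic_pairs A s)).
Qed.

End ClosedPolygonalLines.

(* Main.v *)
(** Invariance and integrality of the winding number: up to a multiple of 2 pi,
    angles at O add up along a path, and around a triangle that misses O they
    add up exactly.

    Injectivity: let the stations be P_k = O + (cos (k pi / 2), sin (k pi / 2)),
    and let the spiral to k be P_0 P_1 ... P_k (P_0 P_(-1) ... P_k if k < 0).
    Say that a point lies in the quadrant k if its direction from O is between
    those of P_k (included) and P_(k+1) (excluded).  In a line starting at P_0,
    replace the part up to a vertex A in the quadrant k by the spiral to k
    followed by A.  If the next vertex C satisfies OA . OC > 0, then it lies in
    the quadrant k - 1, k or k + 1, and a few elementary cancellations in an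
    open half plane bounded by a line through O extend (or unwind) the spiral;
    every other edge is first broken into two such edges.  So every line is
    homotopic to the spiral to some 4 n followed by P_0, and the winding number
    of this line is n. *)
From Stdlib Require Import Relation_Operators.
Require Import Defs.
From mathcomp Require Import all_boot all_order all_algebra.
From mathcomp Require Import all_classical all_reals all_analysis.
From mathcomp Require Import ring lra.
Import Order.TTheory GRing.Theory Num.Theory.
Import numFieldNormedType.Exports.

Set Implicit Arguments.
Unset Strict Implicit.
Unset Printing Implicit Defensive.

Local Open Scope classical_set_scope.
Local Open Scope ring_scope.

(** * Half planes, convex hulls, and segments that miss O *)

Section Plane.
Variable R : realType.
Implicit Types (O A B C u v w : plane R) (S : set (plane R)).

Definition dot u v : R := u.1 * v.1 + u.2 * v.2.
Definition cross u v : R := u.1 * v.2 - u.2 * v.1.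

Lemma plane_eq u v : u.1 = v.1 -> u.2 = v.2 -> u = v.
Proof. by case: u v => [? ?] [? ?] /= -> ->. Qed.

Lemma add_pairE u v : u + v = (u.1 + v.1, u.2 + v.2). Proof. by []. Qed.
Lemma opp_pairE u : - u = (- u.1, - u.2). Proof. by []. Qed.
Lemma scale_pairE (k : R) u : k *: u = (k * u.1, k * u.2). Proof. by []. Qed.

Definition planeE := (add_pairE, opp_pairE, scale_pairE).

Lemma convex_comb S A B (a b : R) :
  convex_set S -> S A -> S B -> 0 <= a -> 0 <= b -> a + b = 1 ->
  S (a *: A + b *: B).
Proof.
move=> cS SA SB a0 b0 ab.
have a1 : a <= 1 by lra.
have := cS A B (Itv01 a0 a1); rewrite !inE => /(_ SA SB).
have -> : b = 1 - a by lra.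
exact.
Qed.

Lemma convex_open_half_plane v O : convex_set [set A | 0 < dot v (A - O)].
Proof.
move=> A B t; rewrite !inE /=.
have -> : conv t A B = t%:num *: (A : plane R) + (1 - t%:num) *: (B : plane R).
  by [].
have t0 : 0 <= t%:num by [].
have t1 : t%:num <= 1 by [].
move: (t%:num) t0 t1 => {}t t0 t1; rewrite /dot !planeE /=.
set a := (X in 0 < X -> _); set b := (X in _ -> 0 < X -> _) => pa pb.
rewrite [ltRHS](_ : _ = t * a + (1 - t) * b); last by rewrite /a /b; ring.
have [->|tn] := eqVneq t 0; first by lra.
by have : 0 < t by [rewrite lt_def tn]; nra.
Qed.

(** An open half plane with O on its boundary is convex and misses O. This is how hulls are later
    shown to lie in the punctured plane. *)
Lemma hull_half_plane v O S :
  (forall A, S A -> 0 < dot v (A - O)) -> convex_hull S `<=` ~` [set O].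
Proof.
move=> h; apply: (@subset_trans _ [set A | 0 < dot v (A - O)]).
  by apply: smallest_sub => //; exact: convex_open_half_plane.
by move=> A /= + /= AO; rewrite AO subrr /dot /= !mulr0 addr0 ltxx.
Qed.

Lemma convex_hull_convex S : convex_set (convex_hull S).
Proof.
move=> A B t; rewrite !inE => hA hB T [cT ST].
by have := cT A B t; rewrite !inE; apply; [apply: hA|apply: hB].
Qed.

Lemma segment_hull S A B : S A -> S B -> segment A B `<=` convex_hull S.
Proof.
move=> SA SB _ [t + <-]; rewrite /= in_itv /= => /andP[t0 t1].
apply: convex_comb; rewrite ?subr_ge0 ?subrK //.
- exact: convex_hull_convex.
- exact: sub_gen_smallest.
- exact: sub_gen_smallest.
Qed.

(** After division by [a + b + c] the relation says that O is the barycenter of A, B, C. It is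
    reached by two binary combinations, first on AB, where [a + b] is nonzero, and then towards
    C. *)
Lemma hull3_center O A B C (a b c : R) : 0 < a -> 0 < b -> 0 <= c ->
  a *: (A - O) + b *: (B - O) + c *: (C - O) = 0 ->
  convex_hull [set A; B; C] O.
Proof.
move=> a0 b0 c0 e; pose H := convex_hull [set A; B; C].
have cH : convex_set H by exact: convex_hull_convex.
have HA : H A by apply: sub_gen_smallest; left; left.
have HB : H B by apply: sub_gen_smallest; left; right.
have HC : H C by apply: sub_gen_smallest; right.
have s0 : 0 < a + b by lra.
have d0 : 0 < a + b + c by lra.
have HD : H ((a / (a + b)) *: A + (b / (a + b)) *: B).
  apply: convex_comb => //; rewrite ?divr_ge0 // ?ltW //.
  by field; lra.
suff -> : O = ((a + b) / (a + b + c)) *: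
    ((a / (a + b)) *: A + (b / (a + b)) *: B) + (c / (a + b + c)) *: C.
  apply: convex_comb => //; rewrite ?divr_ge0 // ?ltW //.
  by field; lra.
have e1 : a * (A.1 - O.1) + b * (B.1 - O.1) + c * (C.1 - O.1) = 0.
  exact: (congr1 fst e).
have e2 : a * (A.2 - O.2) + b * (B.2 - O.2) + c * (C.2 - O.2) = 0.
  exact: (congr1 snd e).
apply: plane_eq; rewrite !planeE /=; apply: (mulfI (lt0r_neq0 d0)).
  rewrite [RHS](_ : _ = a * A.1 + b * B.1 + c * C.1); first by nra.
  by field; lra.
rewrite [RHS](_ : _ = a * A.2 + b * B.2 + c * C.2); first by nra.
by field; lra.
Qed.

Lemma segment_separation O A B : segment A B `<=` ~` [set O] ->
  exists v, 0 < dot v (A - O) /\ 0 < dot v (B - O).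
Proof.
move=> sO; set a := A - O; set b := B - O.
have [c0|cN0] := eqVneq (cross a b) 0; last first.
  have c2 : 0 < cross a b ^+ 2 by rewrite exprn_even_gt0.
  (* A normal to the line AB; the factor [cross a b] points it away from O, since both products
     become a square. *)
  exists (cross a b *: ((b.2 - a.2, a.1 - b.1) : plane R)).
  have e1 : dot (cross a b *: ((b.2 - a.2, a.1 - b.1) : plane R)) a =
      cross a b ^+ 2.
    by rewrite scale_pairE /dot /cross /=; ring.
  have e2 : dot (cross a b *: ((b.2 - a.2, a.1 - b.1) : plane R)) b =
      cross a b ^+ 2.
    by rewrite scale_pairE /dot /cross /=; ring.
  by rewrite e1 e2.
have aa : 0 < dot a a.
  have -> : dot a a = a.1 ^+ 2 + a.2 ^+ 2 by rewrite /dot; ring.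
  rewrite lt_def addr_ge0 ?sqr_ge0 // andbT paddr_eq0 ?sqr_ge0 // !sqrf_eq0.
  apply/negP => /andP[/eqP a1 /eqP a2].
  have : segment A B A.
    exists 0; first by rewrite /= in_itv /= lexx ler01.
    by rewrite subr0 scale1r scale0r addr0.
  move/sO; apply; rewrite /= -[LHS](subrK O).
  by rewrite -/a [a](_ : _ = 0) ?add0r //; exact: plane_eq.
(* Here a and b are collinear, so a itself serves unless b points the other way. *)
exists a; split=> //; rewrite ltNge; apply/negP => ab.
have s0 : 0 < dot a a - dot a b by lra.
(* The parameter at which [dot a ((1 - t) *: a + t *: b)] vanishes; by collinearity the point of the
   segment there is O. *)
pose t := dot a a / (dot a a - dot a b).
have := sO ((1 - t) *: A + t *: B); apply => /=.
  exists t => //; rewrite /= in_itv /= /t divr_ge0 ?(ltW aa) ?(ltW s0) //=.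
  by rewrite ler_pdivrMr // mul1r; lra.
rewrite -[LHS](subrK O) -[RHS]add0r; congr (_ + O).
have -> : (1 - t) *: A + t *: B - O = (1 - t) *: a + t *: b.
  by apply: plane_eq; rewrite !planeE /=; ring.
have -> : 1 - t = - dot a b / (dot a a - dot a b) by rewrite /t; field; lra.
clearbody a b; rewrite /t; move: (lt0r_neq0 s0).
set d := dot a a - dot a b => d0.
apply: plane_eq; rewrite !planeE /=.
  rewrite [LHS](_ : _ = - (a.2 * cross a b) / d); first by rewrite c0; lra.
  by rewrite /dot /cross; field.
rewrite [LHS](_ : _ = (a.1 * cross a b) / d); first by rewrite c0; lra.
by rewrite /dot /cross; field.
Qed.

End Plane.

(** * Arguments of vectors modulo full turns, and oriented angles *)

Section Angles.
Variable R : realType.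
Implicit Types (O A B C u v w : plane R) (s t : R) (n : int).

(** In complex notation [dot u v] and [cross u v] are the real and imaginary parts of conj(u) v, so
    t is an argument of v / u, determined only modulo 2 pi. *)
Definition polar t u v :=
  exists2 r : R, 0 < r & dot u v = r * cos t /\ cross u v = r * sin t.

Lemma dot_gt0 u : u != 0 -> 0 < dot u u.
Proof.
move=> u0; have -> : dot u u = u.1 ^+ 2 + u.2 ^+ 2 by rewrite /dot; ring.
rewrite lt_def addr_ge0 ?sqr_ge0 // andbT paddr_eq0 ?sqr_ge0 // !sqrf_eq0.
by apply: contra u0 => /andP[/eqP ? /eqP ?]; apply/eqP; exact: plane_eq.
Qed.

Lemma codirected_polar t u v :
  u != 0 -> codirected v (rotate t u) <-> polar t u v.
Proof.
move=> u0; have uu := dot_gt0 u0; split=> [[k k0 ->]|[r r0 [d c]]].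
  exists (k * dot u u); first exact: mulr_gt0.
  by rewrite /dot /cross /rotate !planeE /=; split; ring.
exists (r / dot u u); first exact: divr_gt0.
move: (lt0r_neq0 uu) => uu0.
apply: plane_eq; rewrite /rotate !planeE /=; apply: (mulfI uu0).
  rewrite [LHS](_ : _ = dot u v * u.1 - cross u v * u.2).
    by rewrite d c; field.
  by rewrite /dot /cross; ring.
rewrite [LHS](_ : _ = cross u v * u.1 + dot u v * u.2).
  by rewrite d c; field.
by rewrite /dot /cross; ring.
Qed.

(** This is the product of conj(u) v and conj(v) w, which equals |v|^2 conj(u) w, written in
    coordinates. *)
Lemma polar_trans s t u v w :
  v != 0 -> polar s u v -> polar t v w -> polar (s + t) u w.
Proof.
move=> v0 [a a0 [d c]] [b b0 [d' c']]; have vv := dot_gt0 v0.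
move: (lt0r_neq0 vv) => vv0.
exists (a * b / dot v v); first by rewrite divr_gt0 // mulr_gt0.
split; apply: (mulfI vv0).
  rewrite [LHS](_ : _ = dot u v * dot v w - cross u v * cross v w).
    by rewrite d c d' c' cosD; field.
  by rewrite /dot /cross; ring.
rewrite [LHS](_ : _ = cross u v * dot v w + dot u v * cross v w).
  by rewrite d c d' c' sinD; field.
by rewrite /dot /cross; ring.
Qed.

Lemma polar_opp t u v : polar t u v -> polar (- t) v u.
Proof.
move=> [r r0 [d c]]; exists r => //; rewrite cosN sinN mulrN -d -c.
by rewrite /dot /cross; split; ring.
Qed.

Lemma polar_refl_cos t u : u != 0 -> polar t u u -> cos t = 1.
Proof.
move=> /dot_gt0 uu [r r0 [d c]].
have s0 : sin t = 0.
  apply: (mulfI (lt0r_neq0 r0)); rewrite -c mulr0 /cross; ring.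
have : 0 < cos t by rewrite -(pmulr_rgt0 _ r0) -d.
have := cos2Dsin2 t; rewrite s0 expr0n addr0 => /eqP.
by rewrite sqrf_eq1 => /orP[/eqP //|/eqP ->]; lra.
Qed.

Lemma polar_coordinates (x y : R) : (x, y) != 0 ->
  exists t, - pi < t <= pi /\
    exists2 r, 0 < r & x = r * cos t /\ y = r * sin t.
Proof.
move=> xy0; set r := Num.sqrt (x ^+ 2 + y ^+ 2).
have s0 : 0 < x ^+ 2 + y ^+ 2.
  have := @dot_gt0 ((x, y) : plane R) xy0.
  by rewrite /dot /= -!expr2.
have r0 : 0 < r by rewrite sqrtr_gt0.
have r2 : r ^+ 2 = x ^+ 2 + y ^+ 2 by rewrite sqr_sqrtr // ltW.
have yr : (y / r) ^+ 2 = 1 - (x / r) ^+ 2.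
  have rr : r != 0 by rewrite gt_eqF.
  apply: (mulfI (expf_neq0 2 rr)).
  rewrite [LHS](_ : _ = y ^+ 2); last by field.
  rewrite [RHS](_ : _ = r ^+ 2 - x ^+ 2); last by field.
  by rewrite r2; ring.
have c1 : -1 <= x / r <= 1.
  by have := sqr_ge0 (y / r); rewrite yr => ?; apply/andP; split; nra.
have cK : cos (acos (x / r)) = x / r by apply: acosK; rewrite in_itv.
have sK : sin (acos (x / r)) = `|y| / r.
  by rewrite sin_acos // -yr sqrtr_sqr normrM [`|r^-1|]gtr0_norm // invr_gt0.
have rx : x = r * (x / r) by rewrite mulrC divfK // gt_eqF.
have ry z : z = r * (z / r) by rewrite mulrC divfK // gt_eqF.
have a0 := acos_ge0 c1; have a1 := acos_lepi c1; have p0 := pi_gt0 R.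
(* The arccosine settles x; the sign of y decides between it and its opposite. *)
have [y0|y0] := leP 0 y.
  exists (acos (x / r)); split; first by apply/andP; split; lra.
  by exists r => //; rewrite cK sK ger0_norm -?rx -?ry.
exists (- acos (x / r)); split; last first.
  by exists r => //; rewrite cosN sinN cK sK ltr0_norm // mulNr opprK -rx -ry.
(* The value - pi is excluded from the range: it would need x / r = -1, hence y = 0. *)
suff : acos (x / r) < pi by move=> ?; apply/andP; split; lra.
apply: acos_ltpi; case/andP: c1 => c1 ->; rewrite andbT lt_neqAle c1 andbT.
apply/eqP => e; move: yr; rewrite -e sqrrN expr1n subrr => /eqP.
by rewrite sqrf_eq0 mulf_eq0 invr_eq0 (lt_eqF y0) (gt_eqF r0).
Qed.

(** The double angle formula gives sin (t / 2) = 0, and t / 2 lies strictly between - pi and pi. *)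
Lemma cos_eq1 t : cos t = 1 -> - (2 * pi) < t < 2 * pi -> t = 0.
Proof.
move=> c1 /andP[t1 t2].
have s0 : sin (t / 2) = 0.
  have : cos (t / 2 *+ 2) = 1 by rewrite -mulr_natr divfK ?pnatr_eq0.
  rewrite cos_mulr2n cos2sin2 => h; apply/eqP; rewrite -sqrf_eq0; apply/eqP.
  by lra.
have [t0|t0|//] := ltgtP t 0.
  have : 0 < sin (- (t / 2)) by apply: sin_gt0_pi; apply/andP; split; lra.
  by rewrite sinN s0 oppr0 ltxx.
have : 0 < sin (t / 2) by apply: sin_gt0_pi; apply/andP; split; lra.
by rewrite s0 ltxx.
Qed.

Lemma cosD2pin t n : cos (t + n%:~R * (2 * pi)) = cos t.
Proof.
have nat_case (k : nat) x : cos (x + k%:R * (2 * pi)) = cos x :> R.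
  by rewrite !mulr_natl; exact: (periodicn (@cosD2pi R)).
case: n => k; first exact: nat_case.
by rewrite NegzE mulrNz mulNr -[LHS](nat_case k.+1) subrK.
Qed.

Lemma cos_eq1_2pi t : cos t = 1 -> exists n, t = n%:~R * (2 * pi).
Proof.
move=> c1; have p0 := pi_gt0 R.
have p2 : 0 < 2 * pi :> R by lra.
set n := Num.floor (t / (2 * pi)); exists n.
have /andP[n1 n2] := floor_itv (t / (2 * pi)); rewrite -/n in n1 n2.
rewrite intrD in n2; rewrite ler_pdivlMr // in n1; rewrite ltr_pdivrMr // in n2.
apply/eqP; rewrite -subr_eq0; apply/eqP; apply: cos_eq1.
  by rewrite -mulNr -mulrNz cosD2pin.
by apply/andP; split; lra.
Qed.

Lemma oriented_angleP O A B : A != O -> B != O ->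
  - pi < oriented_angle A O B <= pi /\
  polar (oriented_angle A O B) (A - O) (B - O).
Proof.
move=> AO BO; set u := A - O; set v := B - O.
have u0 : u != 0 by rewrite subr_eq0.
have v0 : v != 0 by rewrite subr_eq0.
suff : exists t, - pi < t <= pi /\ codirected v (rotate t u).
  by move=> /(xgetPex 0)[h1 h2]; split=> //; apply/codirected_polar.
have [|t [tpi [r r0 rt]]] := @polar_coordinates (dot u v) (cross u v).
  apply/eqP => -[d c]; have /lt0r_neq0 : 0 < dot u u * dot v v.
    by rewrite mulr_gt0 // dot_gt0.
  rewrite [_ * _](_ : _ = dot u v ^+ 2 + cross u v ^+ 2).
    by rewrite d c expr0n addr0 eqxx.
  by rewrite /dot /cross; ring.
by exists t; split=> //; apply/codirected_polar => //; exists r.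
Qed.

(** Two arguments of the same vector differ by a multiple of 2 pi, and within the half-open range by
    less than 2 pi. *)
Lemma oriented_angleE O A B t : A != O -> B != O ->
  - pi < t <= pi -> polar t (A - O) (B - O) -> oriented_angle A O B = t.
Proof.
move=> AO BO tpi pt; have [spi ps] := oriented_angleP AO BO.
apply/eqP; rewrite -subr_eq0; apply/eqP; apply: cos_eq1; last first.
  by apply/andP; split; lra.
apply: (@polar_refl_cos _ (A - O)); first by rewrite subr_eq0.
apply: polar_trans ps _; first by rewrite subr_eq0.
exact: polar_opp.
Qed.

Lemma oriented_angle_id O A : A != O -> oriented_angle A O A = 0.
Proof.
move=> AO; have p0 := pi_gt0 R.
apply: oriented_angleE => //; first by apply/andP; split; lra.
exists (dot (A - O) (A - O)); first by rewrite dot_gt0 // subr_eq0.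
by rewrite cos0 sin0 /cross; split; ring.
Qed.

(** An angle pi would put O between A and B, but a linear form is positive on both [A - O] and
    [B - O]. *)
Lemma hull_oriented_angle_lt_pi O A B S : S A -> S B ->
  convex_hull S `<=` ~` [set O] -> oriented_angle A O B < pi.
Proof.
move=> SA SB hS.
have hO : segment A B `<=` ~` [set O].
  by apply: subset_trans hS; exact: segment_hull.
have NO X : S X -> X != O.
  by move=> SX; apply/eqP; apply: hS; exact: sub_gen_smallest.
have [/andP[_ a1] [r r0 [d c]]] := oriented_angleP (NO _ SA) (NO _ SB).
rewrite lt_neqAle a1 andbT; apply/eqP => e; rewrite e cospi sinpi in d c.
have [v [v1 v2]] := segment_separation hO.
have uu : 0 < dot (A - O) (A - O) by rewrite dot_gt0 // subr_eq0 NO.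
(* Expands [B - O] along [A - O] and its normal; at angle pi the right side is negative. *)
have : dot (A - O) (A - O) * dot v (B - O) =
    dot (A - O) (B - O) * dot v (A - O) +
    cross (A - O) (B - O) * cross (A - O) v.
  by rewrite /dot /cross; ring.
rewrite d c; set x := dot v (B - O) in v2 *; set y := dot v (A - O) in v1 *.
have : 0 < dot (A - O) (A - O) * x by exact: mulr_gt0.
have : 0 < r * y by exact: mulr_gt0.
by lra.
Qed.

(* The angles AOB + BOC - AOC sum to a multiple of 2 pi of absolute value below
   3 pi. If it is not 0, then all three angles of the oriented triangle ABC have
   the same sign, so that O is a positive combination of A, B, C. *)
Lemma oriented_angle_triangle O A B C :
  convex_hull [set A; B; C] `<=` ~` [set O] ->
  oriented_angle A O C = oriented_angle A O B + oriented_angle B O C.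
Proof.
move=> hO; set S := [set A; B; C].
have SA : S A by left; left.
have SB : S B by left; right.
have SC : S C by right.
have NO X : S X -> X != O.
  by move=> SX; apply/eqP; apply: hO; exact: sub_gen_smallest.
have lt X Y : S X -> S Y -> oriented_angle X O Y < pi.
  by move=> SX SY; apply: (hull_oriented_angle_lt_pi SX SY).
have := lt _ _ SA SB; have := lt _ _ SB SC; have := lt _ _ SA SC.
have [] := oriented_angleP (NO _ SA) (NO _ SB).
have [] := oriented_angleP (NO _ SB) (NO _ SC).
have [] := oriented_angleP (NO _ SA) (NO _ SC).
have A0 : A - O != 0 by rewrite subr_eq0 NO.
have B0 : B - O != 0 by rewrite subr_eq0 NO.
have C0 : C - O != 0 by rewrite subr_eq0 NO.
set a := oriented_angle A O B; set b := oriented_angle B O C.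
set c := oriented_angle A O C => /andP[c1 _] pc /andP[b1 _] pb /andP[a1 _] pa.
move=> c2 b2 a2.
have cos1 : cos (a + b - c) = 1.
  apply: (polar_refl_cos A0); apply: (polar_trans C0); last exact: polar_opp.
  exact: polar_trans pb.
suff : a + b - c = 0 by lra.
case: pa pb pc => [ra ra0 [_ ea]] [rb rb0 [_ eb]] [rc rc0 [_ ec]].
(* The signed areas of OBC, OCA and OAB serve as barycentric weights of O; their signs are those of
   the sines of b, - c and a. *)
have id : cross (B - O) (C - O) *: (A - O) + cross (C - O) (A - O) *: (B - O)
    + cross (A - O) (B - O) *: (C - O) = 0.
  by apply: plane_eq; rewrite /cross !planeE /=; ring.
have crossC : cross (C - O) (A - O) = - cross (A - O) (C - O).
  by rewrite /cross; ring.
have gt0 t : 0 < t -> t < pi -> 0 < sin t.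
  by move=> ? ?; apply: sin_gt0_pi; apply/andP.
apply: (cos_eq1 cos1); apply/andP; split; rewrite ltNge; apply/negP => h.
- case: (hO O) => //.
  have sa : 0 < sin (- a) by apply: gt0; lra.
  have sb : 0 < sin (- b) by apply: gt0; lra.
  have sc : 0 < sin c by apply: gt0; lra.
  apply: (@hull3_center _ _ _ _ _ (rb * sin (- b)) (rc * sin c)
    (ra * sin (- a))); rewrite ?mulr_gt0 // ?ltW ?mulr_gt0 //.
  by rewrite !sinN !mulrN -eb -ec -ea -[RHS]oppr0 -id crossC !scaleNr;
    rewrite !opprD opprK.
- case: (hO O) => //.
  have sa : 0 < sin a by apply: gt0; lra.
  have sb : 0 < sin b by apply: gt0; lra.
  have sc : 0 < sin (- c) by apply: gt0; lra.
  apply: (@hull3_center _ _ _ _ _ (rb * sin b) (rc * sin (- c))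
    (ra * sin a)); rewrite ?mulr_gt0 // ?ltW ?mulr_gt0 //.
  by rewrite sinN mulrN -eb -ec -ea -id crossC.
Qed.

End Angles.

(** * Angle sums and edges along paths; closed lines as paths that return to their start *)

Section Homotopy.
Variable R : realType.
Implicit Types (O A B C x y z : plane R) (N : set (plane R)).
Implicit Types (s t u v : seq (plane R)) (l : closed_line R).

Fixpoint path_angle O x s : R :=
  if s is y :: s' then oriented_angle x O y + path_angle O y s' else 0.

Fixpoint path_in N x s : Prop :=
  if s is y :: s' then segment x y `<=` N /\ path_in N y s' else True.

Lemma path_angle_cat O x s t :
  path_angle O x (s ++ t) = path_angle O x s + path_angle O (last x s) t.
Proof. by elim: s x => [|y s IH] x /=; rewrite ?add0r // IH addrA. Qed.

Lemma path_angle_rcons O x s y : path_angle O x (rcons s y) =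
  path_angle O x s + oriented_angle (last x s) O y.
Proof. by rewrite -cats1 path_angle_cat /= addr0. Qed.

Lemma path_in_cat N x s t :
  path_in N x (s ++ t) <-> path_in N x s /\ path_in N (last x s) t.
Proof.
elim: s x => [|y s IH] x /=; first by split=> // -[].
by split=> [[? /IH[]]|[[? ?] ?]]; split=> //; apply/IH.
Qed.

Lemma path_in_rcons N x s y : path_in N x (rcons s y) <->
  path_in N x s /\ segment (last x s) y `<=` N.
Proof.
rewrite -cats1; split; first by move/path_in_cat=> [? [? _]].
by move=> [? ?]; apply/path_in_cat; split.
Qed.

Lemma winding_number_path O x s :
  winding_number (cyc x s) O = path_angle O x (rcons s x) / (2 * pi).
Proof.
rewrite winding_number_cyc /cyclic_pairs rot1_cons; congr (_ / _).
(* The start z is freed from the end x to make the induction on s possible. *)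
suff h z : \sum_(e <- zip (z :: s) (rcons s x)) oriented_angle e.1 O e.2 =
    path_angle O z (rcons s x) by exact: h.
elim: s z => [|y s IH] z /=; first by rewrite big_seq1 addr0.
by rewrite big_cons IH.
Qed.

Lemma line_in_path N x s : line_in N (cyc x s) <-> path_in N x (rcons s x).
Proof.
rewrite line_in_cyc /cyclic_pairs rot1_cons.
suff h z : (forall e, e \in zip (z :: s) (rcons s x) -> segment e.1 e.2 `<=` N)
    <-> path_in N z (rcons s x) by exact: h.
elim: s z => [|y s IH] z /=.
  split=> [h|[h _] e]; last by rewrite inE => /eqP->.
  by split=> //; apply: (h (z, x)); rewrite inE.
split=> [h|[h /IH hs] e]; last by rewrite inE => /orP[/eqP->|/hs].
split; first by apply: (h (z, y)); rewrite inE eqxx.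
by apply/IH => e es; apply: h; rewrite inE es orbT.
Qed.

(* The value at [::] is junk. *)
Definition line_of s : closed_line R :=
  if s is x :: s' then cyc x s' else cyc 0 [::].

(** Used to bring the vertex to be cancelled to the front, where [cancellation] expects it. *)
Lemma line_of_catC s t : line_of (s ++ t) = line_of (t ++ s).
Proof.
case: s t => [|x s] [|y t] //=; rewrite ?cats0 //.
apply/eqmodP; apply/cyclic_shiftP; exists (size (x :: s)) => /=.
exact: esym (rot_size_cat (x :: s) (y :: t)).
Qed.

Lemma closed_line_cyc l : exists x s, l = cyc x s.
Proof.
rewrite -(reprK l); case: (repr l) => -[//|x s] h; exists x, s.
by congr (\pi_(cyclic_seq _) _)%qT; exact: val_inj.
Qed.

(** * Homotopy as the equivalence relation generated by cancellations *)

Lemma cancellation_line_in N l l' :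
  cancellation N l l' -> line_in N l <-> line_in N l'.
Proof.
move=> [B [C [s [-> -> h]]]].
have seg X Y : [set last C s; B; C] X -> [set last C s; B; C] Y ->
    segment X Y `<=` N.
  by move=> SX SY; apply: subset_trans h; exact: segment_hull.
have hA : [set last C s; B; C] (last C s) by left; left.
have hB : [set last C s; B; C] B by left; right.
have hC : [set last C s; B; C] C by right.
split=> [/line_in_path /= [_ /path_in_rcons[? _]]|].
  by apply/line_in_path/path_in_rcons; split=> //; exact: seg.
move=> /line_in_path/path_in_rcons[? _]; apply/line_in_path => /=; split.
  exact: seg.
by apply/path_in_rcons; split=> //; exact: seg.
Qed.

Lemma homotopic_trans N l1 l2 l3 :
  homotopic N l1 l2 -> homotopic N l2 l3 -> homotopic N l1 l3.
Proof.
move=> [ls [[h1 h2] <-]] [ls' [[h1' h2'] <-]]; exists (ls ++ ls').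
rewrite last_cat; split=> //; split; last by rewrite /= cat_path; apply/andP.
move=> l; rewrite -cat_cons mem_cat => /orP[/h1//|ll'].
by apply: h1'; rewrite inE ll' orbT.
Qed.

Definition cancel_eq N := clos_refl_sym_trans _ (@cancellation R N).

(** Homotopies in both directions are carried along so that the symmetry case of the induction goes
    through. *)
Lemma cancel_eq_homotopic N l l' : cancel_eq N l l' ->
  [/\ line_in N l <-> line_in N l', line_in N l -> homotopic N l l' &
      line_in N l' -> homotopic N l' l].
Proof.
elim=> {l l'} [l l' c|l|l l' _ [? ? ?]|l1 l2 l3 _ [i1 f1 b1] _ [i2 f2 b2]].
- have i := cancellation_line_in c; split=> // [h|h].
  + exists [:: l']; split=> //; split.
    by move=> k; rewrite !inE => /orP[/eqP->|/eqP->] //; exact/i.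
    by rewrite /= andbT; apply/asboolP; left.
  + exists [:: l]; split=> //; split.
    by move=> k; rewrite !inE => /orP[/eqP->|/eqP->] //; exact/i.
    by rewrite /= andbT; apply/asboolP; right.
- have r (h : line_in N l) : homotopic N l l.
    by exists [::]; split=> //; split=> // k; rewrite inE => /eqP->; exact: h.
  by split=> // h; exact: r.
- by split=> //; split=> ?; tauto.
- split; first by tauto.
    by move=> h; apply: (homotopic_trans (f1 h)); apply: f2; tauto.
  by move=> h; apply: (homotopic_trans (b2 h)); apply: b1; tauto.
Qed.

Lemma homotopicP N l l' : homotopic N l l' <-> line_in N l /\ cancel_eq N l l'.
Proof.
split=> [[ls [[h p] <-]]|[h /cancel_eq_homotopic[_ f _]]]; last exact: f.
split; first by apply: h; rewrite mem_head.
elim: ls l h p => [|k ls IH] l h /=; first by move=> _; exact: rst_refl.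
move=> /andP[/asboolP lk p]; apply: (@rst_trans _ _ _ k).
  by case: lk => c; [apply: rst_step|apply: rst_sym; apply: rst_step].
by apply: IH => // j jl; apply: h; rewrite inE jl orbT.
Qed.

Lemma cancel_eq_homotopy_class N l l' : cancel_eq N l l' -> line_in N l ->
  homotopy_class N l = homotopy_class N l'.
Proof.
move=> c h; apply/seteqP; split=> k /homotopicP[_ ck]; apply/homotopicP.
  split; first by have [i _ _] := cancel_eq_homotopic c; apply/i.
  by apply: rst_trans ck; exact: rst_sym.
by split=> //; apply: rst_trans ck.
Qed.

Lemma homotopy_class_cancel_eq N l l' : line_in N l' ->
  homotopy_class N l = homotopy_class N l' -> cancel_eq N l l'.
Proof.
move=> h e; have : homotopy_class N l' l'.
  by apply/homotopicP; split=> //; exact: rst_refl.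
by rewrite -e => /homotopicP[].
Qed.

(** * Replacing a stretch of a closed line, whatever the rest of the line is *)

Definition path_eq N s t :=
  forall u v, cancel_eq N (line_of (u ++ s ++ v)) (line_of (u ++ t ++ v)).

Lemma path_eq_refl N s : path_eq N s s.
Proof. by move=> u v; exact: rst_refl. Qed.

Lemma path_eq_sym N s t : path_eq N s t -> path_eq N t s.
Proof. by move=> h u v; apply: rst_sym; exact: h. Qed.

Lemma path_eq_trans N s t r : path_eq N s t -> path_eq N t r -> path_eq N s r.
Proof. by move=> h1 h2 u v; exact: rst_trans (h1 u v) (h2 u v). Qed.

Lemma path_eq_cat N u v s t :
  path_eq N s t -> path_eq N (u ++ s ++ v) (u ++ t ++ v).
Proof. by move=> h u' v'; rewrite -!catA !(catA u'); exact: h. Qed.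

Lemma path_eq_cancel N A B C : convex_hull [set A; B; C] `<=` N ->
  path_eq N [:: A; B; C] [:: A; C].
Proof.
move=> h u v; rewrite /= -(cat_rcons A u (B :: _)) -(cat_rcons A u (C :: _)).
rewrite [X in cancel_eq _ X _]line_of_catC.
rewrite [X in cancel_eq _ _ X]line_of_catC /=.
apply: rst_step; exists B, C, (v ++ rcons u A); split=> //.
by rewrite last_cat last_rcons.
Qed.

Lemma hull_segment O A B (S : set (plane R)) : segment A B `<=` ~` [set O] ->
  S `<=` [set A; B] -> convex_hull S `<=` ~` [set O].
Proof.
move=> /segment_separation[v [vA vB]] SAB; apply: (@hull_half_plane _ v).
by move=> C /SAB[->|->].
Qed.

(** Moves the base vertex from x to y: first x is doubled, then the spur x y x is inserted. Both
    hulls degenerate to segments that miss O. *)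
Lemma cancel_eq_conj O x y s : line_in (~` [set O]) (cyc x s) ->
  segment x y `<=` ~` [set O] ->
  cancel_eq (~` [set O]) (cyc x s) (cyc y (x :: rcons s x)).
Proof.
move=> /line_in_path/path_in_rcons[_ hx] hy.
apply: (@rst_trans _ _ _ (cyc x (x :: s))).
  apply/rst_sym/rst_step; exists x, x, s; split=> //.
  by apply: (hull_segment hx) => z [[->|->]|->]; by [left|right].
have -> : cyc x (x :: s) = cyc x (rcons s x).
  by rewrite -cats1; exact: (line_of_catC [:: x] (x :: s)).
apply/rst_sym/rst_step; exists y, x, (rcons s x); split=> //.
by apply: (hull_segment hy) => z; rewrite last_rcons => -[[->|->]|->];
  by [left|right].
Qed.

Lemma half_plane_segment O A B C : 0 < dot C (A - O) -> 0 < dot C (B - O) ->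
  segment A B `<=` ~` [set O].
Proof.
move=> hA hB; apply: subset_trans (@hull_half_plane _ C O [set A; B] _).
  by apply: segment_hull; [left|right].
by move=> z [->|->].
Qed.

(** * Integrality and homotopy invariance of the winding number *)

Lemma path_angle_polar O x s : x != O -> path_in (~` [set O]) x s ->
  polar (path_angle O x s) (x - O) (last x s - O).
Proof.
elim: s x => [|y s IH] x xO /=.
  move=> _; exists (dot (x - O) (x - O)); first by rewrite dot_gt0 // subr_eq0.
  by rewrite cos0 sin0 /cross; split; ring.
move=> [h /IH{}IH].
have yO : y != O.
  apply/eqP; apply: (h y); exists 1; first by rewrite /= in_itv /= lexx ler01.
  by rewrite subrr scale0r scale1r add0r.
have y0 : y - O != 0 by rewrite subr_eq0.
by apply: (polar_trans y0 _ (IH yO)); have [] := oriented_angleP xO yO.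
Qed.

Lemma line_in_neq O x s : line_in (~` [set O]) (cyc x s) -> x != O.
Proof.
move=> /line_in_path/path_in_rcons[_ h].
apply/eqP; apply: (h x); exists 1; first by rewrite /= in_itv /= lexx ler01.
by rewrite subrr scale0r scale1r add0r.
Qed.

(** The total angle of a closed path is an argument of a vector relative to itself, hence a multiple
    of 2 pi. *)
Lemma winding_number_int O l : line_in (~` [set O]) l ->
  exists n : int, winding_number l O = n%:~R.
Proof.
have [x [s ->]] := closed_line_cyc l => h.
have xO := line_in_neq h.
have p := path_angle_polar xO ((line_in_path _ _ _).1 h).
rewrite last_rcons in p.
have [|n e] := cos_eq1_2pi (polar_refl_cos _ p); first by rewrite subr_eq0.
exists n; rewrite winding_number_path e mulfK //.
by have := pi_gt0 R; lra.
Qed.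

Lemma cancellation_winding_number O l l' :
  cancellation (~` [set O]) l l' -> winding_number l O = winding_number l' O.
Proof.
move=> [B [C [s [-> -> h]]]]; rewrite !winding_number_path; congr (_ / _).
rewrite /= !path_angle_rcons (oriented_angle_triangle h); lra.
Qed.

Lemma cancel_eq_winding_number O l l' : cancel_eq (~` [set O]) l l' ->
  winding_number l O = winding_number l' O.
Proof.
elim=> {l l'} [l l'|l|l l' _ ->|l k l' _ -> _ ->] //.
exact: cancellation_winding_number.
Qed.

End Homotopy.

(** * Stations, spirals and quadrants around O *)

Section StandardLines.
Variables (R : realType) (O : plane R).
Implicit Types (A B C x y : plane R) (s t : seq (plane R)) (k d : int).
Local Notation N := (~` [set O]).

Definition quarter k : R := k%:~R * (pi / 2).

Definition cardinal k : plane R := (cos (quarter k), sin (quarter k)).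

Definition station k : plane R := O + cardinal k.

(** The sign d, 1 or -1, is the sense of rotation and n counts quarter turns, so there are n + 1
    stations. *)
Definition arc d (n : nat) := [seq station (d * i%:Z) | i <- iota 0 n.+1].

Definition spiral k := if k is Posz n then arc 1 n else arc (-1) `|k|.

(** As a condition on A this depends on k modulo 4 only; the integer k itself records how far the
    spiral has turned. *)
Definition in_quadrant k A :=
  0 < dot (cardinal k) (A - O) /\ 0 <= dot (cardinal (k + 1)) (A - O).

Lemma quarterD k : quarter (k + 1) = quarter k + pi / 2.
Proof. by rewrite /quarter intrD mulrDl mul1r. Qed.

Lemma quarterB k : quarter (k - 1) = quarter k - pi / 2.
Proof. by rewrite /quarter intrD mulrDl mulN1r. Qed.

Lemma cardinalD k : cardinal (k + 1) = (- (cardinal k).2, (cardinal k).1).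
Proof. by rewrite /cardinal quarterD cosDpihalf sinDpihalf. Qed.

Lemma cardinalB k : cardinal (k - 1) = ((cardinal k).2, - (cardinal k).1).
Proof. by rewrite /cardinal quarterB cosBpihalf sinBpihalf. Qed.

Lemma cardinal_dot k : dot (cardinal k) (cardinal k) = 1.
Proof. by rewrite /dot -!expr2 cos2Dsin2. Qed.

Lemma stationB k : station k - O = cardinal k.
Proof. by rewrite /station addrC addKr. Qed.

Lemma station0 : station 0 = O + ((1, 0) : plane R).
Proof. by rewrite /station /cardinal /quarter mul0r cos0 sin0. Qed.

Lemma arcS d n : arc d n.+1 = rcons (arc d n) (station (d * n.+1%:Z)).
Proof. by rewrite /arc -[n.+2]addn1 iotaD map_cat cats1. Qed.

Lemma arc_last d n : exists s, arc d n = rcons s (station (d * n%:Z)).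
Proof.
case: n => [|n]; first by exists [::].
by rewrite arcS; exists (arc d n).
Qed.

Lemma spiral_arc d n : d = 1 \/ d = -1 -> spiral (d * n%:Z) = arc d n.
Proof.
move=> [->|->]; first by rewrite mul1r.
by case: n => [|n]; rewrite ?mulr0 // mulN1r -NegzE.
Qed.

Lemma spiral_arcE k :
  exists d n, [/\ d = 1 \/ d = -1, k = d * n%:Z & spiral k = arc d n].
Proof.
case: k => n; first by exists 1, n; rewrite mul1r; split=> //; left.
by exists (-1), n.+1; rewrite NegzE mulN1r; split=> //; right.
Qed.

Lemma spiral_last k : exists s, spiral k = rcons s (station k).
Proof. by have [d [n [_ -> ->]]] := spiral_arcE k; exact: arc_last. Qed.

(** A step away from 0 appends a station, a step towards 0 drops the last one. *)
Lemma spiral_succ k d : d = 1 \/ d = -1 ->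
  spiral (k + d) = rcons (spiral k) (station (k + d)) \/
  spiral k = rcons (spiral (k + d)) (station k).
Proof.
move=> hd; have [d' [n [hd' kE ->]]] := spiral_arcE k.
have app : d = d' -> spiral (k + d) = rcons (arc d' n) (station (k + d)).
  move=> ->; have -> : k + d' = d' * n.+1%:Z.
    by rewrite kE intS mulrDr mulr1 addrC.
  by rewrite spiral_arc // arcS.
have [/app|dd'] := eqVneq d d'; first by left.
(* At k = 0 the spiral is a single station without a sense of rotation, so a step either way
   appends. *)
case: n kE app => [|n] kE _.
  left; have -> : k + d = d * 1%:Z by rewrite kE mulr0 add0r mulr1.
  by rewrite spiral_arc // arcS /arc /= !mulr0.
right; have -> : k + d = d' * n%:Z.
  have -> : d = - d' by move: hd hd' dd' => [->|->] [->|->].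
  by rewrite kE intS mulrDr mulr1 addrC addKr.
by rewrite spiral_arc // arcS kE.
Qed.

(** * Following a path by a spiral *)

Lemma path_eq_half_plane v A B C : 0 < dot v (A - O) -> 0 < dot v (B - O) ->
  0 < dot v (C - O) -> path_eq N [:: A; B; C] [:: A; C].
Proof.
move=> hA hB hC; apply: path_eq_cancel; apply: (@hull_half_plane _ v).
by move=> x [[->|->]|->].
Qed.

(** All four points lie in the half plane of v. Station k + d is inserted between A and C, and A is
    cancelled. If the spiral shrinks, the detour from station k + d to station k and back is
    cancelled as well. *)
Lemma spiral_turn k d v A C : d = 1 \/ d = -1 ->
  0 < dot v (cardinal k) -> 0 < dot v (cardinal (k + d)) ->
  0 < dot v (A - O) -> 0 < dot v (C - O) ->
  path_eq N (spiral k ++ [:: A; C]) (spiral (k + d) ++ [:: C]).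
Proof.
move=> hd; rewrite -!stationB => hk hkd hA hC.
apply: (@path_eq_trans _ _ _ (spiral k ++ [:: station (k + d); C])).
  have [s ->] := spiral_last k; rewrite -!cats1 -!catA /=.
  have e := path_eq_half_plane.
  apply: (@path_eq_trans _ _ _ (s ++ [:: station k; A; station (k + d); C])).
    apply: path_eq_sym.
    have := @path_eq_cat _ N (s ++ [:: station k]) [::] _ _
      (e v A _ C hA hkd hC).
    by rewrite !cats0 -!catA.
  have := @path_eq_cat _ N s [:: C] _ _ (e v _ A _ hk hA hkd).
  by [].
have [->|e] := spiral_succ k hd.
  by rewrite cat_rcons; exact: path_eq_refl.
have [s es] := spiral_last (k + d); rewrite e es -!cats1 -!catA /=.
apply: (@path_eq_trans _ _ _ (s ++ [:: station (k + d); station (k + d); C])).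
  exact: (@path_eq_cat _ N s [:: C] _ _ (path_eq_half_plane hkd hk hkd)).
have := @path_eq_cat _ N s [::] _ _ (path_eq_half_plane hkd hkd hC).
by rewrite !cats0.
Qed.

Lemma quadrant_step k A C : in_quadrant k A -> 0 < dot (A - O) (C - O) ->
  exists2 k', in_quadrant k' C &
    path_eq N (spiral k ++ [:: A; C]) (spiral k' ++ [:: C]).
Proof.
move=> [a0 b0] AC; have e1 := cardinal_dot k.
set e := cardinal k in a0 e1; set f := cardinal (k + 1) in b0.
set a := dot e (A - O) in a0; set b := dot f (A - O) in b0.
pose c := dot e (C - O); pose d := dot f (C - O).
have fE : f = (- e.2, e.1) by exact: cardinalD.
have gE : cardinal (k - 1) = (e.2, - e.1) by exact: cardinalB.
have {}AC : 0 < a * c + b * d.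
  suff : a * c + b * d = dot (A - O) (C - O) by move->.
  rewrite -[RHS]mul1r -e1 /a /b /c /d fE; rewrite /dot /=; ring.
have lin p q x : dot (p *: e + q *: f) x = p * dot e x + q * dot f x.
  by rewrite /dot !planeE /=; ring.
have fe : dot f e = 0 by rewrite fE /dot /=; ring.
have ef : dot e f = 0 by rewrite fE /dot /=; ring.
have ff : dot f f = 1 by rewrite -e1 fE /dot /=; ring.
have eg : dot e (cardinal (k - 1)) = 0 by rewrite gE /dot /=; ring.
have fg : dot f (cardinal (k - 1)) = -1 by rewrite -e1 fE gE /dot /=; ring.
(* In the orthonormal frame e, f the points A and C have coordinates (a, b) and (c, d). The signs of
   c and d give the quadrant k, k - 1 or k + 1; in the last case [AC] fails. *)
have [c0|c0] := ltP 0 c; have [d0|d0] := leP 0 d.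
- exists k; first by split.
  have [s ->] := spiral_last k; rewrite -cats1 -!catA /=.
  have := @path_eq_cat _ N s [::] _ _
    (@path_eq_half_plane e (station k) A C _ a0 c0).
  by rewrite !cats0; apply; rewrite stationB -/e e1.
- exists (k - 1).
    split; rewrite ?subrK; last exact: ltW.
    rewrite gE; suff -> : dot (e.2, - e.1) (C - O) = - d by lra.
    by rewrite /d fE /dot /=; ring.
  (* The vector [b *: e - a *: f] is normal to OA and positive on C and on station k - 1; adding e
     makes it positive on A and on station k too. *)
  apply: (@spiral_turn _ _ ((1 + b) *: e + (- a) *: f)); first by right.
  + by rewrite lin e1 fe; lra.
  + by rewrite lin eg fg; lra.
  + by rewrite lin -/a -/b; nra.
  + by rewrite lin -/c -/d; nra.
- have {}d0 : 0 < d by nra.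
  exists (k + 1).
    split=> //; rewrite cardinalD -/f.
    suff -> : dot (- f.2, f.1) (C - O) = - c by lra.
    by rewrite /c fE /dot /=; ring.
  (* Likewise [d *: e - c *: f] is normal to OC, and adding f makes all four products positive. *)
  apply: (@spiral_turn _ _ (d *: e + (1 - c) *: f)); first by left.
  + by rewrite lin e1 fe; lra.
  + by rewrite lin ef ff; lra.
  + by rewrite lin -/a -/b; nra.
  + by rewrite lin -/c -/d; nra.
- by nra.
Qed.

(* Breaks the edge AC at O + v, where v is as in segment_separation. *)
Lemma segment_step k A C : in_quadrant k A -> segment A C `<=` N ->
  exists2 k', in_quadrant k' C &
    path_eq N (spiral k ++ [:: A; C]) (spiral k' ++ [:: C]).
Proof.
move=> qA /segment_separation[v [vA vC]].
have vv : 0 < dot v v.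
  apply: dot_gt0; apply/eqP => v0; move: vA.
  by rewrite v0 /dot /= !mul0r addr0 ltxx.
have vM : O + v - O = v by rewrite addrC addKr.
have [|k1 q1 h1] := @quadrant_step k A (O + v) qA.
  by rewrite vM; move: vA; rewrite /dot ![v.1 * _]mulrC ![v.2 * _]mulrC.
have [|k2 q2 h2] := @quadrant_step k1 (O + v) C q1; first by rewrite vM.
exists k2 => //; apply: (path_eq_trans _ h2).
apply: (@path_eq_trans _ _ _ (spiral k ++ [:: A; O + v; C])).
  have h : path_eq N [:: A; O + v; C] [:: A; C].
    by apply: (@path_eq_half_plane v); rewrite ?vM.
  have := @path_eq_cat _ N (spiral k) [::] _ _ (path_eq_sym h).
  by rewrite !cats0.
by have := @path_eq_cat _ N [::] [:: C] _ _ h1; rewrite /= -!catA.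
Qed.

Lemma path_spiral k A s : in_quadrant k A -> path_in N A s ->
  exists2 k', in_quadrant k' (last A s) &
    path_eq N (spiral k ++ A :: s) (spiral k' ++ [:: last A s]).
Proof.
elim: s k A => [|B s IH] k A qA /=.
  by move=> _; exists k => //; exact: path_eq_refl.
move=> [AB Bs]; have [k1 q1 h1] := segment_step qA AB.
have [k2 q2 h2] := IH _ _ q1 Bs; exists k2 => //; apply: path_eq_trans h2.
by have := @path_eq_cat _ N [::] s _ _ h1; rewrite /= -!catA.
Qed.

(** * Reduction of every closed line to a standard line *)

Definition standard_line (n : int) : closed_line R :=
  line_of (spiral (4 * n) ++ [:: station 0]).

Lemma in_quadrant_station0 k : in_quadrant k (station 0) ->
  exists n, k = 4 * n.
Proof.
rewrite /in_quadrant stationB /cardinal /quarter mul0r cos0 sin0 => -[+ _].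
rewrite {1}/dot /= mulr1 mulr0 addr0.
rewrite {1}(divz_eq k 4) mulrC; set q := (k %/ 4)%Z; set r := (k %% 4)%Z => h.
suff r0 : r = 0 by exists q; rewrite {1}(divz_eq k 4) -/q -/r r0 addr0 mulrC.
move: h; rewrite intrD mulrDr [X in cos X]addrC.
have -> : pi / 2 * (q * 4)%:~R = q%:~R * (2 * pi) :> R by rewrite intrM; field.
rewrite cosD2pin.
have r4 : 0 <= r by exact: modz_ge0.
have : r < 4 by exact: ltz_pmod.
case: r r4 => // -[|[|[|[|m]]]] //= _ _.
- by rewrite mulr1 cos_pihalf ltxx.
- by rewrite (_ : pi / 2 * _ = pi); [rewrite cospi oppr_gt0 ltr10|field].
- rewrite (_ : pi / 2 * _ = pi + pi / 2); last by field.
  by rewrite cosDpihalf sinpi oppr0 ltxx.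
Qed.

(** Conjugation moves the base vertex to station 0. The segment from x to station 0 meets O only if
    x is on the ray opposite to station 0; then the move passes through station 1. *)
Lemma cancel_eq_standard_line l : line_in N l ->
  exists n, cancel_eq N l (standard_line n).
Proof.
have [x [s ->]] := closed_line_cyc l.
have E k : station k - O = cardinal k := stationB k.
have c0 : cardinal 0 = (1, 0) by rewrite /cardinal /quarter mul0r cos0 sin0.
have c1 : cardinal 1 = (0, 1).
  by rewrite -[1]add0r cardinalD c0 /= oppr0.
have base t : line_in N (cyc (station 0) t) ->
    exists n, cancel_eq N (cyc (station 0) t) (standard_line n).
  move=> h; have p := (line_in_path _ _ _).1 h.
  have [|k] := @path_spiral 0 (station 0) (rcons t (station 0)) _ p.
    by rewrite /in_quadrant E add0r c0 c1 /dot /=; split; lra.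
  rewrite last_rcons => /in_quadrant_station0[n ->] e; exists n.
  (* Conjugation by station 0 itself supplies two extra copies of it: one is the spiral to 0, the
     other the end of the path. *)
  apply: (@rst_trans _ _ _
    (cyc (station 0) (station 0 :: rcons t (station 0)))).
    apply: cancel_eq_conj => //.
    by apply: (@half_plane_segment _ _ _ _ (cardinal 0));
      rewrite E cardinal_dot.
  by have := e [::] [::]; rewrite !cats0 /= /arc /= mulr0.
have via_vertex y z t : (forall t, line_in N (cyc y t) ->
      exists n, cancel_eq N (cyc y t) (standard_line n)) ->
    segment z y `<=` N -> line_in N (cyc z t) ->
    exists n, cancel_eq N (cyc z t) (standard_line n).
  move=> yP zy h; have e := cancel_eq_conj h zy.
  have [i _ _] := cancel_eq_homotopic e.
  by have [n e'] := yP _ (i.1 h); exists n; exact: rst_trans e'.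
move=> h; have [a aE] : exists a, a = x - O by exists (x - O).
have [a1|a1] := ltP 0 a.1.
  apply: (via_vertex _ _ _ base _ h).
  apply: (@half_plane_segment _ _ _ _ (1, 0)).
    by rewrite -aE /dot /=; lra.
  by rewrite E c0 /dot /=; lra.
have [a2|a2] := eqVneq a.2 0; last first.
  apply: (via_vertex _ _ _ base _ h).
  (* The normal to the line through x and station 0, scaled by [a.2] so that both products equal the
     square of [a.2]. *)
  apply: (@half_plane_segment _ _ _ _ (a.2 ^+ 2, (1 - a.1) * a.2)).
    rewrite -aE /dot /= [ltRHS](_ : _ = a.2 ^+ 2); last by ring.
    by rewrite exprn_even_gt0.
  by rewrite E c0 /dot /= mulr0 mulr1 addr0 exprn_even_gt0.
have {}a1 : a.1 < 0.
  rewrite lt_neqAle a1 andbT; apply/eqP => a10.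
  have := line_in_neq h; rewrite -subr_eq0 -aE => /eqP; apply.
  exact: plane_eq.
apply: (via_vertex (station 1) _ _ _ _ h).
  move=> t; apply: (via_vertex _ _ _ base).
  apply: (@half_plane_segment _ _ _ _ (1, 1)).
    by rewrite E c1 /dot /=; lra.
  by rewrite E c0 /dot /=; lra.
apply: (@half_plane_segment _ _ _ _ (-1, 1)).
  by rewrite -aE /dot /= a2; lra.
by rewrite E c1 /dot /=; lra.
Qed.

(** * Winding numbers of the standard lines *)

Lemma station_neq k : station k != O.
Proof.
rewrite -subr_eq0 stationB; apply/eqP => e; have := cardinal_dot k.
by rewrite e /dot /= mul0r addr0 => /eqP; rewrite eq_sym oner_eq0.
Qed.

Lemma station_angle k d : d = 1 \/ d = -1 ->
  oriented_angle (station k) O (station (k + d)) = d%:~R * (pi / 2).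
Proof.
move=> hd; have p0 := pi_gt0 R.
have NO := station_neq.
apply: oriented_angleE => //.
  by case: hd => ->; apply/andP; rewrite ?mulrNz; split; lra.
exists 1 => //; rewrite !mul1r !stationB; have := cardinal_dot k.
case: hd => ->.
  rewrite cardinalD mul1r cos_pihalf sin_pihalf /dot /cross /= => <-.
  by split; ring.
rewrite cardinalB mulrNz mulN1r cosN sinN cos_pihalf sin_pihalf /dot /cross /=.
by move=> <-; split; ring.
Qed.

Lemma station_segment k d : d = 1 \/ d = -1 ->
  segment (station k) (station (k + d)) `<=` N.
Proof.
move=> hd.
(* The two cardinal vectors are orthonormal, so their sum has product 1 with each. *)
apply: (@half_plane_segment _ _ _ _ (cardinal k + cardinal (k + d)));
  rewrite !stationB; have := cardinal_dot k; case: hd => ->;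
  rewrite ?cardinalD ?cardinalB; move: (cardinal k) => e e1;
  rewrite [ltRHS](_ : _ = dot e e); do ?[by rewrite e1 ltr01];
  rewrite /dot planeE /=; ring.
Qed.

Lemma arc_path d n : d = 1 \/ d = -1 -> exists s,
  [/\ arc d n = station 0 :: s, last (station 0) s = station (d * n%:Z),
    path_in N (station 0) s &
    path_angle O (station 0) s = (d * n%:Z)%:~R * (pi / 2)].
Proof.
move=> hd; elim: n => [|n [s [e l p a]]].
  by exists [::]; split; rewrite /arc //= mulr0 ?mul0r.
have kE : d * n.+1%:Z = d * n%:Z + d by rewrite intS mulrDr mulr1 addrC.
exists (rcons s (station (d * n.+1%:Z))); rewrite arcS e last_rcons; split=> //.
  by apply/path_in_rcons; rewrite l kE; split=> //; exact: station_segment.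
by rewrite path_angle_rcons l a kE station_angle // intrD [RHS]mulrDl.
Qed.

Lemma station_period n : station (4 * n) = station 0.
Proof.
have c1 : cos (quarter (4 * n)) = 1.
  rewrite -[RHS]cos0 -[in RHS](cosD2pin 0 n) add0r /quarter intrM.
  by congr cos; field.
rewrite station0 /station /cardinal c1 cos1sin0 //.
by rewrite c1 normr1.
Qed.

(** The spiral contributes 4 n quarter turns; the two remaining edges join station 0 to itself and
    contribute 0. *)
Lemma standard_line_in_winding n :
  line_in N (standard_line n) /\ winding_number (standard_line n) O = n%:~R.
Proof.
have p0 := pi_gt0 R.
have [d [m [hd kE e]]] := spiral_arcE (4 * n); rewrite /standard_line e.
have [s [-> l p a]] := arc_path m hd; rewrite -kE in l a.
rewrite station_period in l.
have O0 := station_neq 0.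
have loop : segment (station 0) (station 0) `<=` N.
  by apply: (@half_plane_segment _ _ _ _ (cardinal 0));
    rewrite stationB cardinal_dot.
split.
  apply/line_in_path/path_in_rcons; rewrite last_cat; split=> //.
  by apply/path_in_cat; rewrite l.
rewrite winding_number_path path_angle_rcons path_angle_cat last_cat l a /=.
rewrite oriented_angle_id // !addr0 intrM; field; lra.
Qed.

End StandardLines.

(** * The winding number as a bijection from homotopy classes to integers *)

Theorem proposition4p2 (R : realType) (O : plane R) :
  exists f : set (closed_line R) -> int,
    (forall l : closed_line R, line_in (~` [set O]) l ->
       (f (homotopy_class (~` [set O]) l))%:~R = winding_number l O) /\
    set_bij (homotopy_classes (~` [set O])) [set: int] f.
Proof.
pose N := ~` [set O].
(* The default 0 is taken only when X is not a homotopy class of a line in N, because winding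
   numbers are integers. *)
pose f (X : set (closed_line R)) : int := xget 0
  [set n | exists l, [/\ line_in N l, X = homotopy_class N l &
                         winding_number l O = n%:~R]].
have fE l : line_in N l -> (f (homotopy_class N l))%:~R = winding_number l O.
  move=> h; rewrite /f; case: xgetP => [_ _ [k [hk ek <-]]|none].
    exact/cancel_eq_winding_number/homotopy_class_cancel_eq.
  by have [n ln] := winding_number_int h; case: (none n); exists l.
exists f; split=> //; split=> //.
  (* Injectivity: both lines reduce to standard lines, whose indices are their winding numbers and
     therefore agree. *)
  move=> _ _ /set_mem[l hl <-] /set_mem[k hk <-] e.
  have [n ln] := cancel_eq_standard_line hl.
  have [m km] := cancel_eq_standard_line hk.
  have nm : n = m.
    apply: (@intr_inj R).
    rewrite -(standard_line_in_winding O n).2 -(standard_line_in_winding O m).2.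
    rewrite -(cancel_eq_winding_number ln) -(cancel_eq_winding_number km).
    by rewrite -!fE // e.
  apply: cancel_eq_homotopy_class => //; apply: rst_trans ln _.
  by rewrite nm; exact: rst_sym.
move=> n _; have [h w] := standard_line_in_winding O n.
exists (homotopy_class N (standard_line O n)).
  by exists (standard_line O n).
by apply: (@intr_inj R); rewrite fE.
Qed.
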